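(* $$\frac{15\pi}{4\sqrt{3}} = \sum_{k=0}^{\infty}\left(-\frac1{27}\right)^{k}\frac{\left(\frac12\right)_k\left(\frac23\right)_k(1)_k}{\left(\frac43\right)_k\left(\frac43\right)_k\left(\frac{11}{6}\right)_k}\,\left(21k^2+26k+7\right).$$
   Context: For $k\in\mathbb{N}_0$, $(\alpha)_k=\alpha(\alpha+1)\cdots(\alpha+k-1)$ is the rising factorial (Pochhammer symbol), with $(\alpha)_0=1$. *)

(* Defs.v *)
From Stdlib Require Import Reals.
From Coquelicot Require Import Coquelicot.
Open Scope R_scope.

Fixpoint pochhammer (a : R) (k : nat) : R :=
  match k with
  | O => 1
  | S j => pochhammer a j * (a + INR j)
  end.

(* Main.v *)
(** The series is an accelerated form of
    sum_k (-1)^k (1/(3k+1) - 1/(3k+3)) = PI/(3 sqrt 3).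
    Start from the well-poised sum over k of
      (-1)^k (a+2k) (b)_k (c)_k (d)_k / ((1+a-b)_k (1+a-c)_k (1+a-d)_k)
    at (a,b,c,d) = (4/3,1,2/3,1/3), and move the parameters n times by (3,1,1,0).
    With a suitable normalisation the shifted summand F(n,k) has a
    Wilf-Zeilberger mate G, that is F(n+1,k) - F(n,k) = G(n,k+1) - G(n,k), so
    sum_k F(0,k) = sum_n G(n,0).  Both sums are multiples of the two series above. *)

Require Import Defs.
From Stdlib Require Import Reals Lra Lia.
From Coquelicot Require Import Coquelicot.
Open Scope R_scope.

(** * Positivity and general summation of WZ pairs *)

Lemma pochhammer_pos (a : R) (k : nat) : 0 < a -> 0 < pochhammer a k.
Proof.
intros Ha; induction k as [|k IH]; simpl; [lra|].
pose proof (pos_INR k); apply Rmult_lt_0_compat; lra.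
Qed.

(** The WZ equation is summed over the rectangle n <= N, k <= K: the left side telescopes in n, the
    right side in k, and only the four edges remain. *)
Lemma WZ_telescoping (F G : nat -> nat -> R) :
  (forall n k, F (S n) k - F n k = G n (S k) - G n k) ->
  forall N K, sum_n (fun n => G n O) N
    = sum_n (fun n => G n (S K)) N + sum_n (F O) K - sum_n (F (S N)) K.
Proof.
intros WZ N K.
assert (row : forall n, sum_n (F (S n)) K - sum_n (F n) K = G n (S K) - G n O).
{ intros n; induction K as [|K IH].
  - rewrite !sum_O; apply WZ.
  - rewrite !sum_Sn; unfold plus; simpl; specialize (WZ n (S K)); lra. }
induction N as [|N IH].
- rewrite !sum_O; specialize (row O); lra.
- rewrite !sum_Sn; unfold plus; simpl; specialize (row (S N)); lra.
Qed.

Lemma is_lim_seq_sum_n_0 (a : nat -> nat -> R) (N : nat) :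
  (forall n, is_lim_seq (a n) 0) ->
  is_lim_seq (fun K => sum_n (fun n => a n K) N) 0.
Proof.
intros Ha; induction N as [|N IH].
- apply is_lim_seq_ext with (a O); [|apply Ha].
  intros K; now rewrite sum_O.
- apply is_lim_seq_ext with (fun K => sum_n (fun n => a n K) N + a (S N) K).
  { intros K; now rewrite sum_Sn. }
  replace (Finite 0) with (Finite (0 + 0)) by (f_equal; lra).
  now apply is_lim_seq_plus'.
Qed.

Lemma is_series_of_error_le (a eps : nat -> R) (l : R) :
  (forall N, Rabs (sum_n a N - l) <= eps N) -> is_lim_seq eps 0 -> is_series a l.
Proof.
intros bound Heps.
enough (lim : is_lim_seq (fun N => sum_n a N - l) 0).
{ pose proof (is_lim_seq_plus' _ _ _ _ lim (is_lim_seq_const l)) as sum_lim.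
  rewrite Rplus_0_l in sum_lim.
  refine (is_lim_seq_ext _ _ _ _ sum_lim).
  intros N; unfold Rminus; rewrite Rplus_assoc, Rplus_opp_l; apply Rplus_0_r. }
apply is_lim_seq_abs_0.
apply is_lim_seq_le_le with (fun _ => 0) eps.
- intros N; split; [apply Rabs_pos|apply bound].
- apply is_lim_seq_const.
- exact Heps.
Qed.

(* The error after N terms is the row sum of F (S N), once K tends to infinity. *)
Lemma WZ_is_series (F G : nat -> nat -> R) (eps : nat -> R) (l : R) :
  (forall n k, F (S n) k - F n k = G n (S k) - G n k) ->
  (forall n, is_lim_seq (G n) 0) ->
  (forall n K, Rabs (sum_n (F n) K) <= eps n) ->
  is_lim_seq eps 0 ->
  is_series (F O) l ->
  is_series (fun n => G n O) l.
Proof.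
intros WZ HG HF Heps Hl.
assert (bound : forall N, Rabs (sum_n (fun n => G n O) N - l) <= eps (S N)).
{ intros N.
  assert (lim : is_lim_seq (fun K => Rabs (sum_n (fun n => G n O) N
                 - (sum_n (fun n => G n (S K)) N + sum_n (F O) K)))
                 (Rabs (sum_n (fun n => G n O) N - (0 + l)))).
  { apply (is_lim_seq_abs _ (Finite _)).
    apply is_lim_seq_minus'; [apply is_lim_seq_const|].
    apply is_lim_seq_plus'; [|exact Hl].
    apply (is_lim_seq_sum_n_0 (fun n K => G n (S K))).
    intros n; apply -> is_lim_seq_incr_1; apply HG. }
  rewrite Rplus_0_l in lim.
  refine (is_lim_seq_le _ _ (Finite _) (Finite _) _ lim (is_lim_seq_const (eps (S N)))).
  intros K; rewrite (WZ_telescoping F G WZ N K).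
  replace (_ - _) with (- sum_n (F (S N)) K) by lra.
  rewrite Rabs_Ropp; apply HF. }
apply is_series_of_error_le with (fun N => eps (S N)); [exact bound|].
apply -> is_lim_seq_incr_1; exact Heps.
Qed.

(** Each new term 1/(K+2)^2 is at most 1/(K+1) - 1/(K+2); keeping the subtracted tail in the bound
    makes the induction close. *)
Lemma sum_n_inv_sqr_le (K : nat) :
  sum_n (fun k => / (INR k + 1) ^ 2) K <= 2 - / (INR K + 1).
Proof.
induction K as [|K IH].
- rewrite sum_O; simpl; lra.
- rewrite sum_Sn; unfold plus; simpl plus; rewrite S_INR.
  pose proof (pos_INR K) as HK.
  enough (/ (INR K + 1 + 1) ^ 2 <= / (INR K + 1) - / (INR K + 1 + 1))
    by (change (Hierarchy.plus ?a ?b) with (a + b); simpl in *; lra).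
  replace (/ (INR K + 1) - / (INR K + 1 + 1))
    with (/ ((INR K + 1) * (INR K + 1 + 1))) by (field; lra).
  apply Rinv_le_contravar; nra.
Qed.

(** * The WZ pair and its edge k = 0 *)

(** Up to a factor in n alone, this is the quotient of Pochhammer symbols of the well-poised summand
    at (a,b,c,d) = (4/3+3n, 1+n, 2/3+n, 1/3); for instance (1+n)_k = (1)_(n+k) / (1)_n. The symbols
    in n alone fix the normalisation. The sign and the factor a+2k are left to [wz_F], so that
    [wz_u] stays positive. *)
Definition wz_u (n k : nat) : R :=
  pochhammer 1 (n + k) * pochhammer (2 / 3) (n + k) * pochhammer (1 / 3) k
  * pochhammer (2 / 3) n * pochhammer 1 (2 * n) * pochhammer (4 / 3) (2 * n)
  / (pochhammer (4 / 3) (2 * n + k) * pochhammer (5 / 3) (2 * n + k)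
     * pochhammer 2 (3 * n + k)).

Lemma wz_u_pos (n k : nat) : 0 < wz_u n k.
Proof.
unfold wz_u; apply Rdiv_lt_0_compat;
  repeat apply Rmult_lt_0_compat; apply pochhammer_pos; lra.
Qed.

(** The quotients under k+1 and n+1 are rational functions, which is what lets [field] check the WZ
    equation and the closed forms below. *)
Lemma wz_u_Sk (n k : nat) :
  wz_u n (S k) = wz_u n k
    * ((1 + INR n + INR k) * (2 / 3 + INR n + INR k) * (1 / 3 + INR k)
       / ((4 / 3 + 2 * INR n + INR k) * (5 / 3 + 2 * INR n + INR k)
          * (2 + 3 * INR n + INR k))).
Proof.
unfold wz_u; rewrite <- !plus_n_Sm; cbn [pochhammer].
rewrite !plus_INR, !mult_INR; simpl (INR 2); simpl (INR 3).
pose proof (pochhammer_pos (4 / 3) (2 * n + k) ltac:(lra)).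
pose proof (pochhammer_pos (5 / 3) (2 * n + k) ltac:(lra)).
pose proof (pochhammer_pos 2 (3 * n + k) ltac:(lra)).
pose proof (pos_INR n); pose proof (pos_INR k).
field; repeat split; lra.
Qed.

Lemma wz_u_Sn (n k : nat) :
  wz_u (S n) k = wz_u n k
    * ((1 + INR n + INR k) * (2 / 3 + INR n + INR k) * (2 / 3 + INR n)
       * (1 + 2 * INR n) * (2 + 2 * INR n) * (4 / 3 + 2 * INR n) * (7 / 3 + 2 * INR n)
       / ((4 / 3 + 2 * INR n + INR k) * (7 / 3 + 2 * INR n + INR k)
          * (5 / 3 + 2 * INR n + INR k) * (8 / 3 + 2 * INR n + INR k)
          * (2 + 3 * INR n + INR k) * (3 + 3 * INR n + INR k) * (4 + 3 * INR n + INR k))).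
Proof.
unfold wz_u.
replace (2 * S n)%nat with (S (S (2 * n))) by lia.
replace (3 * S n)%nat with (S (S (S (3 * n)))) by lia.
rewrite !plus_Sn_m; cbn [pochhammer].
rewrite !S_INR, !plus_INR, !mult_INR; simpl (INR 2); simpl (INR 3).
pose proof (pochhammer_pos (4 / 3) (2 * n + k) ltac:(lra)).
pose proof (pochhammer_pos (5 / 3) (2 * n + k) ltac:(lra)).
pose proof (pochhammer_pos 2 (3 * n + k) ltac:(lra)).
pose proof (pos_INR n); pose proof (pos_INR k).
field; repeat split; lra.
Qed.

Definition wz_F (n k : nat) : R :=
  (-1) ^ (n + k) * (4 / 3 + 3 * INR n + 2 * INR k) * wz_u n k.

(* The certificate wz_R = wz_G / ((-1)^(n+k) wz_u) was found by solving the WZ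
   equation linearly for the coefficients of wz_P, for several values of n. *)
Definition wz_P (x y : R) : R :=
  27 * y ^ 5 + (261 + 378 * x) * y ^ 4 + (987 + 2907 * x + 2079 * x ^ 2) * y ^ 3
  + (1807 + 8076 * x + 11700 * x ^ 2 + 5508 * x ^ 3) * y ^ 2
  + (1510 + 9103 * x + 20025 * x ^ 2 + 19116 * x ^ 3 + 6696 * x ^ 4) * y
  + (448 + 3456 * x + 10352 * x ^ 2 + 15120 * x ^ 3 + 10800 * x ^ 4 + 3024 * x ^ 5).

Definition wz_R (x y : R) : R :=
  wz_P x y / (3 * (4 + 6 * x + 3 * y) * (5 + 6 * x + 3 * y)
              * (2 + 3 * x + y) * (3 + 3 * x + y)).

Definition wz_G (n k : nat) : R :=
  (-1) ^ (n + k) * wz_R (INR n) (INR k) * wz_u n k.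

(** After the two shift quotients are inserted, every term is a multiple of (-1)^(n+k) [wz_u n k],
    leaving an identity of rational functions in n and k. *)
Lemma wz_pair (n k : nat) :
  wz_F (S n) k - wz_F n k = wz_G n (S k) - wz_G n k.
Proof.
unfold wz_F, wz_G; rewrite wz_u_Sn, wz_u_Sk, <- plus_n_Sm, plus_Sn_m, !S_INR.
cbn [pow]; unfold wz_R, wz_P.
pose proof (pos_INR n); pose proof (pos_INR k).
field; repeat split; lra.
Qed.

Lemma wz_G_0 (n : nat) :
  wz_G n 0 = 8 / 45 *
    ((- (1 / 27)) ^ n
     * ((pochhammer (1 / 2) n * pochhammer (2 / 3) n * pochhammer 1 n)
        / (pochhammer (4 / 3) n * pochhammer (4 / 3) n * pochhammer (11 / 6) n))
     * (21 * INR n ^ 2 + 26 * INR n + 7)).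
Proof.
(* The closed form comes from duplication of (1)_(2n) and (5/3)_(2n) and triplication of (2)_(3n),
   the source of 27^n. The factor (5+6n)/5 is (11/6)_n / (5/6)_n. *)
assert (Hu : (-1) ^ n * wz_u n 0 = (5 + 6 * INR n) / 5 *
    ((- (1 / 27)) ^ n
     * ((pochhammer (1 / 2) n * pochhammer (2 / 3) n * pochhammer 1 n)
        / (pochhammer (4 / 3) n * pochhammer (4 / 3) n * pochhammer (11 / 6) n)))).
{ induction n as [|n IH].
  - unfold wz_u; simpl; field.
  - rewrite wz_u_Sn, S_INR; cbn [pow pochhammer]; simpl (INR 0).
    rewrite Rmult_assoc, <- (Rmult_assoc _ (wz_u n 0)), IH.
    pose proof (pochhammer_pos (4 / 3) n ltac:(lra)).
    pose proof (pochhammer_pos (11 / 6) n ltac:(lra)).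
    pose proof (pos_INR n).
    field; repeat split; lra. }
unfold wz_G; rewrite <- plus_n_O.
replace ((-1) ^ n * wz_R (INR n) (INR 0) * wz_u n 0)
  with (wz_R (INR n) (INR 0) * ((-1) ^ n * wz_u n 0)) by ring.
rewrite Hu; simpl (INR 0); unfold wz_R, wz_P.
pose proof (pochhammer_pos (4 / 3) n ltac:(lra)).
pose proof (pochhammer_pos (11 / 6) n ltac:(lra)).
pose proof (pos_INR n).
field; repeat split; lra.
Qed.

(** * The row n = 0 and decay estimates *)

(** At n = 0 the symbols pair up as (s)_k / (s+1)_k = s/(s+k) for s = 1/3, 2/3, 1. *)
Lemma wz_u_0 (k : nat) :
  wz_u 0 k = 2 / 9 / ((INR k + 1 / 3) * (INR k + 2 / 3) * (INR k + 1)).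
Proof.
induction k as [|k IH].
- unfold wz_u; simpl; field.
- rewrite wz_u_Sk, IH, S_INR; simpl (INR 0).
  pose proof (pos_INR k).
  field; repeat split; lra.
Qed.

Lemma wz_u_Sn_le (n k : nat) : wz_u (S n) k <= wz_u n k / 4.
Proof.
rewrite wz_u_Sn.
apply Rmult_le_compat_l; [apply Rlt_le, wz_u_pos|].
pose proof (pos_INR n) as Hx; pose proof (pos_INR k) as Hy.
set (x := INR n) in *; set (y := INR k) in *.
apply Rle_div_l; [repeat apply Rmult_lt_0_compat; lra|].
(* The ratio 1/4 is generous: once denominators are cleared, the difference has only nonnegative
   coefficients in x and y. *)
apply Rminus_le_0; field_simplify.
apply Rmult_le_pos; [|lra].
repeat (apply Rplus_le_le_0_compat || apply Rmult_le_pos || apply pow_le); lra.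
Qed.

(** The cubic decay comes from the row n = 0, and each step in n gains a factor 1/4. *)
Lemma wz_u_le (n k : nat) : wz_u n k <= (/ 4) ^ n / (INR k + 1) ^ 3.
Proof.
induction n as [|n IH].
- rewrite wz_u_0; pose proof (pos_INR k) as Hk.
  replace (2 / 9 / _)
    with (/ (9 / 2 * ((INR k + 1 / 3) * (INR k + 2 / 3) * (INR k + 1))))
    by (field; lra).
  rewrite pow_O; unfold Rdiv at 4; rewrite Rmult_1_l.
  apply Rinv_le_contravar; [apply pow_lt; lra|].
  apply Rminus_le_0; field_simplify.
  apply Rmult_le_pos; [|lra].
  repeat (apply Rplus_le_le_0_compat || apply Rmult_le_pos || apply pow_le); lra.
- eapply Rle_trans; [apply wz_u_Sn_le|].
  replace ((/ 4) ^ S n / (INR k + 1) ^ 3) with ((/ 4) ^ n / (INR k + 1) ^ 3 / 4)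
    by (simpl; unfold Rdiv; ring).
  lra.
Qed.

Lemma S_mult_quarter_pow_le (n : nat) : (INR n + 1) * (/ 4) ^ n <= (/ 2) ^ n.
Proof.
induction n as [|n IH]; [simpl; lra|].
rewrite S_INR; cbn [pow].
pose proof (pos_INR n); pose proof (pow_lt (/ 4) n ltac:(lra)); nra.
Qed.

(** Serves both [wz_F] and [wz_G]: a weight linear in each variable costs one power of k+1, leaving
    a summable bound, and a factor n+1, absorbed by weakening 1/4^n to 1/2^n. *)
Lemma wz_term_le (C c : R) (m n k : nat) :
  0 <= C -> 0 <= c <= C * (INR n + 1) * (INR k + 1) ->
  Rabs ((-1) ^ m * c * wz_u n k) <= C * (/ 2) ^ n * / (INR k + 1) ^ 2.
Proof.
intros HC [Hc HcC].
rewrite !Rabs_mult, pow_1_abs, Rmult_1_l, (Rabs_pos_eq c Hc).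
rewrite (Rabs_pos_eq (wz_u n k)) by apply Rlt_le, wz_u_pos.
pose proof (pos_INR n); pose proof (pos_INR k).
pose proof (pow_lt (/ 4) n ltac:(lra)).
eapply Rle_trans.
{ apply Rmult_le_compat; [exact Hc|apply Rlt_le, wz_u_pos|exact HcC|apply wz_u_le]. }
replace (_ * _) with (C * ((INR n + 1) * (/ 4) ^ n) * / (INR k + 1) ^ 2)
  by (field; lra).
apply Rmult_le_compat_r; [apply Rlt_le, Rinv_0_lt_compat, pow_lt; lra|].
apply Rmult_le_compat_l; [exact HC|apply S_mult_quarter_pow_le].
Qed.

Lemma wz_F_le (n k : nat) : Rabs (wz_F n k) <= 3 * (/ 2) ^ n * / (INR k + 1) ^ 2.
Proof.
apply wz_term_le; [lra|].
pose proof (pos_INR n); pose proof (pos_INR k); nra.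
Qed.

Lemma sum_n_wz_F_le (n K : nat) : Rabs (sum_n (wz_F n) K) <= 6 * (/ 2) ^ n.
Proof.
eapply Rle_trans; [apply (norm_sum_n_m (wz_F n))|].
eapply Rle_trans; [apply (sum_n_m_le _ _ _ _ (wz_F_le n))|].
apply Rle_trans with (3 * (/ 2) ^ n * sum_n (fun k => / (INR k + 1) ^ 2) K);
  [right; exact (sum_n_mult_l (3 * (/ 2) ^ n) _ K)|].
pose proof (pos_INR K).
pose proof (Rinv_0_lt_compat (INR K + 1) ltac:(lra)).
pose proof (pow_lt (/ 2) n ltac:(lra)).
replace (6 * _) with (3 * (/ 2) ^ n * 2) by ring.
apply Rmult_le_compat_l; [lra|].
eapply Rle_trans; [apply sum_n_inv_sqr_le|lra].
Qed.

Lemma wz_R_le (x y : R) :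
  0 <= x -> 0 <= y -> 0 <= wz_R x y <= 10 * (x + 1) * (y + 1).
Proof.
intros Hx Hy; unfold wz_R.
assert (Hd : 0 < 3 * (4 + 6 * x + 3 * y) * (5 + 6 * x + 3 * y)
              * (2 + 3 * x + y) * (3 + 3 * x + y))
  by (repeat apply Rmult_lt_0_compat; lra).
split.
- apply Rle_div_r; [exact Hd|]; rewrite Rmult_0_l; unfold wz_P.
  repeat (apply Rplus_le_le_0_compat || apply Rmult_le_pos || apply pow_le); lra.
(* The constant 10 is large enough for the difference to expand with nonnegative coefficients
   only. *)
- apply Rle_div_l; [exact Hd|]; apply Rminus_le_0.
  unfold wz_P; ring_simplify.
  repeat (apply Rplus_le_le_0_compat || apply Rmult_le_pos || apply pow_le); lra.
Qed.

Lemma is_lim_seq_inv_S : is_lim_seq (fun k => / (INR k + 1)) 0.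
Proof.
apply is_lim_seq_ext with (fun k => / INR (S k)).
{ intros k; now rewrite S_INR. }
apply -> (is_lim_seq_incr_1 (fun k => / INR k)).
exact (is_lim_seq_inv _ _ is_lim_seq_INR ltac:(discriminate)).
Qed.

Lemma wz_G_lim (n : nat) : is_lim_seq (wz_G n) 0.
Proof.
apply is_lim_seq_abs_0.
apply is_lim_seq_le_le with (fun _ => 0) (fun k => 10 * / (INR k + 1)).
- intros k; split; [apply Rabs_pos|].
  eapply Rle_trans;
    [apply (wz_term_le 10); [lra|apply wz_R_le; apply pos_INR]|].
  pose proof (pos_INR k).
  rewrite Rmult_assoc; apply Rmult_le_compat_l; [lra|].
  rewrite <- (Rmult_1_l (/ (INR k + 1))).
  apply Rmult_le_compat.
  + apply pow_le; lra.
  + apply Rlt_le, Rinv_0_lt_compat, pow_lt; lra.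
  + rewrite <- (pow1 n); apply pow_incr; lra.
  + apply Rinv_le_contravar; nra.
- apply is_lim_seq_const.
- replace (Finite 0) with (Rbar_mult 10 0) by (simpl; f_equal; lra).
  apply is_lim_seq_scal_l, is_lim_seq_inv_S.
Qed.

(** * Evaluation of the alternating series of reciprocals *)

(** On [0,1], (m+1) x^m <= 1 + x + ... + x^m, and multiplying by 1-x gives 1 - x^(m+1) <= 1. *)
Lemma one_minus_mult_pow_le (x : R) (m : nat) :
  0 <= x <= 1 -> (1 - x) * x ^ m <= / (INR m + 1).
Proof.
intros Hx; pose proof (pos_INR m).
assert (sum : (INR m + 1) * ((1 - x) * x ^ m) <= 1 - x ^ S m).
{ induction m as [|m IH]; [simpl; lra|].
  specialize (IH (pos_INR m)).
  pose proof (pow_le x m (proj1 Hx)).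
  assert (x ^ m <= 1) by (rewrite <- (pow1 m); apply pow_incr; lra).
  pose proof (Rmult_le_compat_l x _ _ (proj1 Hx) IH) as IHx.
  assert (0 <= (1 - x) * (1 - x * x ^ m)) by (apply Rmult_le_pos; nra).
  rewrite S_INR; cbn [pow] in *; lra. }
pose proof (pow_le x (S m) (proj1 Hx)).
apply (Rmult_le_reg_l (INR m + 1)); [lra|].
rewrite Rinv_r; lra.
Qed.

Lemma is_derive_primitive (x : R) :
  is_derive (fun x => - (1 / 2) * ln (x ^ 2 - x + 1)
                      + / sqrt 3 * atan ((2 * x - 1) / sqrt 3)) x
            ((1 - x) / (x ^ 2 - x + 1)).
Proof.
assert (H3 : sqrt 3 * sqrt 3 = 3) by (apply sqrt_sqrt; lra).
pose proof (sqrt_lt_R0 3 ltac:(lra)) as Hs.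
assert (Hq : 0 < x ^ 2 - x + 1) by nra.
auto_derive; [simpl in Hq; repeat split; lra|].
set (s := sqrt 3) in *.
(* The logarithmic and arctangent parts stay separate. Keeping s * s makes the first equality an
   identity in s; s * s = 3 then gives s * s + (2x-1)^2 = 4 (x^2-x+1). *)
transitivity (- (1 / 2) * ((2 * x - 1) / (x ^ 2 - x + 1))
              + 2 / (s * s + (2 * x - 1) ^ 2)).
- simpl in *; field; repeat split; nra.
- rewrite H3; simpl in *; field; split; nra.
Qed.

(** A geometric sum of ratio -x^3 with first term 1-x^2; 1+x is cancelled from (1-x^2)/(1+x^3). *)
Lemma sum_alternating_pow (x : R) (K : nat) : 0 <= x ->
  sum_n (fun k => (-1) ^ k * (x ^ (3 * k) - x ^ (3 * k + 2))) K
    - (1 - x) / (x ^ 2 - x + 1)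
  = (-1) ^ K * ((1 - x) * x ^ (3 * S K)) / (x ^ 2 - x + 1).
Proof.
intros Hx.
assert (Hq : 0 < x ^ 2 - x + 1) by nra.
induction K as [|K IH].
- rewrite sum_O; simpl in *; field; lra.
- rewrite sum_Sn; change plus with Rplus.
  replace (3 * S (S K))%nat with (3 + 3 * S K)%nat by lia.
  rewrite (Nat.add_comm (3 * S K) 2), !pow_add.
  set (S0 := sum_n _ K) in *.
  replace S0 with ((1 - x) / (x ^ 2 - x + 1)
    + (-1) ^ K * ((1 - x) * x ^ (3 * S K)) / (x ^ 2 - x + 1)) by lra.
  cbn [pow]; simpl in Hq; field; lra.
Qed.

Lemma atan_inv_sqrt3 : atan (1 / sqrt 3) = PI / 6.
Proof.
rewrite <- tan_PI6; apply atan_tan.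
pose proof PI_RGT_0; split; lra.
Qed.

Lemma is_derive_sum_pow (x : R) (K : nat) :
  is_derive (fun x => sum_n (fun k => (-1) ^ k * (x ^ (3 * k + 1) / (3 * INR k + 1)
                                        - x ^ (3 * k + 3) / (3 * INR k + 3))) K) x
    (sum_n (fun k => (-1) ^ k * (x ^ (3 * k) - x ^ (3 * k + 2))) K).
Proof.
apply (is_derive_sum_n (fun k x => (-1) ^ k * (x ^ (3 * k + 1) / (3 * INR k + 1)
                                     - x ^ (3 * k + 3) / (3 * INR k + 3)))).
intros k _.
pose proof (pos_INR k).
auto_derive; [easy|].
change (k + (k + (k + 0)))%nat with (3 * k)%nat.
replace (Init.Nat.pred (3 * k + 1)) with (3 * k)%nat by lia.
replace (Init.Nat.pred (3 * k + 3)) with (3 * k + 2)%nat by lia.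
rewrite !plus_INR, !mult_INR; simpl (INR 3); simpl (INR 1).
field; lra.
Qed.

(** The sum is the integral of (1-x)/(x^2-x+1) over [0,1]. No integral is formed: the mean value
    theorem bounds the change over [0,1] of the partial sum [S] minus the primitive [A]. *)
Lemma is_series_alternating_reciprocals :
  is_series (fun k => (-1) ^ k * (/ (3 * INR k + 1) - / (3 * INR k + 3)))
            (PI / (3 * sqrt 3)).
Proof.
apply is_series_of_error_le with (fun K => 4 / 3 * / (INR K + 1)).
- intros K.
  set (A := fun x => - (1 / 2) * ln (x ^ 2 - x + 1)
                     + / sqrt 3 * atan ((2 * x - 1) / sqrt 3)).
  set (S := fun x => sum_n (fun k => (-1) ^ k * (x ^ (3 * k + 1) / (3 * INR k + 1)
                                        - x ^ (3 * k + 3) / (3 * INR k + 3))) K).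
  (* The quadratic equals 1 at both ends, so the logarithm drops out, while the arctangent runs from
     -PI/6 to PI/6. *)
  assert (HA : A 1 - A 0 = PI / (3 * sqrt 3)).
  { unfold A.
    replace (1 ^ 2 - 1 + 1) with 1 by ring.
    replace (0 ^ 2 - 0 + 1) with 1 by ring.
    replace ((2 * 1 - 1) / sqrt 3) with (1 / sqrt 3) by (f_equal; ring).
    replace ((2 * 0 - 1) / sqrt 3) with (- (1 / sqrt 3)) by (unfold Rdiv; ring).
    rewrite atan_opp, atan_inv_sqrt3.
    pose proof (sqrt_lt_R0 3 ltac:(lra)); field; lra. }
  assert (HS : S 1 - S 0
    = sum_n (fun k => (-1) ^ k * (/ (3 * INR k + 1) - / (3 * INR k + 3))) K).
  { replace (S 0) with 0.
    - rewrite Rminus_0_r; apply sum_n_ext; intros k; rewrite !pow1; unfold Rdiv; rewrite !Rmult_1_l; reflexivity.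
    - symmetry; unfold S; rewrite (sum_n_ext _ (fun _ => 0)).
      + rewrite sum_n_const; ring.
      + intros k; rewrite !pow_i by lia; unfold Rdiv.
        rewrite !Rmult_0_l, Rminus_0_r; apply Rmult_0_r. }
  assert (HD : forall x, 0 <= x -> is_derive (fun x => S x - A x) x
            ((-1) ^ K * ((1 - x) * x ^ (3 * Datatypes.S K)) / (x ^ 2 - x + 1))).
  { intros x Hx; rewrite <- sum_alternating_pow by exact Hx.
    exact (is_derive_minus _ _ _ _ _ (is_derive_sum_pow x K) (is_derive_primitive x)). }
  destruct (MVT_gen (fun x => S x - A x) 0 1
    (fun x => (-1) ^ K * ((1 - x) * x ^ (3 * Datatypes.S K)) / (x ^ 2 - x + 1)))
    as [c [Hc E]]; rewrite Rmin_left, Rmax_right in * by lra.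
  + intros x Hx; apply HD; lra.
  + intros x Hx; apply continuity_pt_filterlim.
    apply (ex_derive_continuous (fun x => S x - A x)).
    eexists; apply HD; lra.
  + rewrite <- HS, <- HA.
    replace (S 1 - S 0 - (A 1 - A 0)) with (S 1 - A 1 - (S 0 - A 0)) by ring.
    rewrite E, Rminus_0_r, Rmult_1_r.
    (* Completing the square gives the minimum 3/4, whence the constant 4/3 in the error bound. *)
    assert (Hq : 3 / 4 <= c ^ 2 - c + 1) by (pose proof (pow2_ge_0 (c - 1 / 2)); nra).
    assert (Hp : 0 <= (1 - c) * c ^ (3 * Datatypes.S K)).
    { apply Rmult_le_pos; [lra|apply pow_le; lra]. }
    unfold Rdiv; rewrite !Rabs_mult, pow_1_abs, Rmult_1_l, <- Rabs_mult.
    rewrite (Rabs_pos_eq _ Hp), Rabs_inv, (Rabs_pos_eq (c ^ 2 - c + 1)) by lra.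
    rewrite Rmult_comm.
    apply Rmult_le_compat.
    * apply Rlt_le, Rinv_0_lt_compat; lra.
    * exact Hp.
    * replace (4 * / 3) with (/ (3 / 4)) by field; apply Rinv_le_contravar; lra.
    (* This gives 1/(3(K+1)+1), weakened to 1/(K+1). *)
    * eapply Rle_trans; [apply one_minus_mult_pow_le; exact Hc|].
      pose proof (pos_INR K).
      apply Rinv_le_contravar; [lra|].
      apply Rplus_le_compat_r, le_INR; lia.
- replace (Finite 0) with (Rbar_mult (4 / 3) 0) by (simpl; f_equal; lra).
  apply is_lim_seq_scal_l, is_lim_seq_inv_S.
Qed.

(** The factor 4/3+2k = 2(k+2/3) cancels against [wz_u_0], leaving (-1)^k 4/((3k+1)(3k+3)), twice
    the alternating difference of reciprocals. *)
Lemma wz_F_0_is_series : is_series (wz_F 0) (2 * PI / (3 * sqrt 3)).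
Proof.
replace (2 * PI / (3 * sqrt 3)) with (2 * (PI / (3 * sqrt 3))) by (unfold Rdiv; ring).
eapply is_series_ext; [|exact (is_series_scal_l 2 _ _ is_series_alternating_reciprocals)].
intros k; unfold wz_F; rewrite wz_u_0, Nat.add_0_l; simpl (INR 0).
pose proof (pos_INR k).
match goal with |- @eq _ (scal ?c ?a) ?b => change (c * a = b) end.
field; lra.
Qed.

Theorem mainTheorem19 :
  is_series
    (fun k : nat =>
       (- (1 / 27)) ^ k
       * ((pochhammer (1 / 2) k * pochhammer (2 / 3) k * pochhammer 1 k)
          / (pochhammer (4 / 3) k * pochhammer (4 / 3) k * pochhammer (11 / 6) k))
       * (21 * INR k ^ 2 + 26 * INR k + 7))
    (15 * PI / (4 * sqrt 3)).
Proof.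
pose proof (sqrt_lt_R0 3 ltac:(lra)).
(* The factor 45/8 undoes the 8/45 of [wz_G_0]. *)
replace (15 * PI / (4 * sqrt 3)) with (45 / 8 * (2 * PI / (3 * sqrt 3))) by (field; lra).
assert (HG : is_series (fun n => wz_G n 0) (2 * PI / (3 * sqrt 3))).
{ apply (WZ_is_series wz_F wz_G (fun n => 6 * (/ 2) ^ n)).
  - exact wz_pair.
  - exact wz_G_lim.
  - exact sum_n_wz_F_le.
  - replace (Finite 0) with (Rbar_mult 6 0) by (simpl; f_equal; lra).
    apply is_lim_seq_scal_l, is_lim_seq_geom; rewrite Rabs_pos_eq; lra.
  - exact wz_F_0_is_series. }
eapply is_series_ext; [|exact (is_series_scal_l (45 / 8) _ _ HG)].
intros n; cbv beta; rewrite wz_G_0.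
match goal with |- @eq _ (scal ?c ?a) ?b => change (c * a = b) end.
rewrite <- Rmult_assoc; replace (45 / 8 * (8 / 45)) with 1 by field.
apply Rmult_1_l.
Qed.
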